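(* If $E/L/K$ is any tower of finite extensions of number fields then $\mathcal{N}_{E/K}=\mathcal{N}_{L/K}\circ\mathcal{N}_{E/L}$ as maps $\mathcal{A}_E\to\mathcal{A}_K$, where $\mathcal{N}$ denotes the norm map of arithmetic symmetric functions.
   Context: For a number field $K$ with ring of integers $\mathcal{O}_K$: $\mathbb{P}_K$ is the set of (nonzero) prime ideals of $\mathcal{O}_K$ and $\mathcal{J}_K^+$ is the monoid of (nonzero) integral ideals. $\mathbb{Q}^{\mathrm{ab}}$ is the maximal abelian extension of $\mathbb{Q}$ and $\Lambda$ is the ring of symmetric functions with coefficients in $\mathbb{Q}^{\mathrm{ab}}$. For each $\mathfrak{q}\in\mathbb{P}_K$ let $\mathfrak{X}^{(\mathfrak{q})}=x_1^{(\mathfrak{q})}+x_2^{(\mathfrak{q})}+\cdots$ be a set of commuting free variables, and let $A_K:=\bigotimes_{\mathfrak{q}\in\mathbb{P}_K}\Lambda[\mathfrak{X}^{(\mathfrak{q})}]$ (direct limit of the tensor products over finite subsets of $\mathbb{P}_K$), graded by $\mathcal{J}_K^+$: an element homogeneous of degree $d_{\mathfrak{q}}$ in each $\mathfrak{X}^{(\mathfrak{q})}$ has degree $\prod_{\mathfrak{q}}\mathfrak{q}^{d_{\mathfrak{q}}}$. The ring of arithmetic symmetric functions $\mathcal{A}_K$ is the completion of $A_K$: formal sums $\sum_{\mathfrak{a}\in\mathcal{J}_K^+}F_{\mathfrak{a}}$ with $F_{\mathfrak{a}}\in A_K$ of degree $\mathfrak{a}$, with the Cauchy product. For a finite extension $L/K$,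 the norm map $\mathcal{N}_{L/K}:\mathcal{A}_L\to\mathcal{A}_K$ is the algebra homomorphism (compatible with infinite sums) given by the substitution $\mathfrak{X}^{(\mathfrak{p})}\mapsto p_{f(\mathfrak{p}|\mathfrak{q})}[\mathfrak{X}^{(\mathfrak{q})}]$, i.e. $x_i^{(\mathfrak{p})}\mapsto (x_i^{(\mathfrak{q})})^{f(\mathfrak{p}|\mathfrak{q})}$ for all $i$, whenever $\mathfrak{p}\in\mathbb{P}_L$ lies over $\mathfrak{q}\in\mathbb{P}_K$, where $f(\mathfrak{p}|\mathfrak{q})=\dim_{\mathcal{O}_K/\mathfrak{q}}(\mathcal{O}_L/\mathfrak{p})$. *)

(* Defs.v *)
From HB Require Import structures.
From mathcomp Require Import all_boot all_order all_algebra all_fingroup all_field.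
From mathcomp Require Import finmap.
From mathcomp Require Import mathcomp_extra boolp classical_sets functions cardinality fsbigop.
From mathcomp.multinomials Require Import monalg.

Set Implicit Arguments.
Unset Strict Implicit.
Unset Printing Implicit Defensive.

Import GRing.Theory.
Local Open Scope ring_scope.
Local Open Scope classical_set_scope.

(** * The maximal abelian extension of Q *)

(* Inside algC, the algebraic closure of Q: the compositum of all finite
   abelian extensions of Q, i.e. the smallest subfield of algC that contains
   the image of every embedding of such an extension. *)
Definition in_Qab (x : algC) : Prop :=
  forall S : {pred algC}, divring_closed S ->
    (forall (F : splittingFieldType rat) (f : {rmorphism F -> algC}),
        galois 1 {:F} -> abelian 'Gal({:F} / 1) -> forall y : F, f y \in S) ->
  x \in S.

Definition Qab_pred : {pred algC} := fun x => `[< in_Qab x >].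

Lemma Qab_divring_closed : divring_closed Qab_pred.
Proof.
split.
- by apply/asboolP=> S [].
- move=> x y /asboolP hx /asboolP hy; apply/asboolP=> S hS hab.
  by case: (hS) => _ hB _; apply: hB; [exact: hx|exact: hy].
- move=> x y /asboolP hx /asboolP hy; apply/asboolP=> S hS hab.
  by case: (hS) => _ _ hD; apply: hD; [exact: hx|exact: hy].
Qed.

HB.instance Definition _ :=
  GRing.isDivringClosed.Build algC Qab_pred Qab_divring_closed.

Record Qab := MkQab { Qab_val : algC; Qab_valP : Qab_val \in Qab_pred }.
HB.instance Definition _ := [isSub for Qab_val].
HB.instance Definition _ := [Choice of Qab by <:].
HB.instance Definition _ := [SubChoice_isSubComUnitRing of Qab by <:].
HB.instance Definition _ := [SubComUnitRing_isSubIntegralDomain of Qab by <:].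
HB.instance Definition _ := [SubIntegralDomain_isSubField of Qab by <:].

(** * Ideals *)

(* [idealr_closed] and [prime_idealr_closed] are the notions of ring_quotient;
   the former includes properness. *)
Definition is_prime_ideal (R : comNzRingType) (p : set R) : Prop :=
  [/\ idealr_closed [in p], prime_idealr_closed [in p]
    & exists2 x, x \in p & x != 0].

Record prime_ideals (R : comNzRingType) :=
  MkPrime { prime_set : set R; primeP : `[< is_prime_ideal prime_set >] }.
HB.instance Definition _ (R : comNzRingType) := [isSub for @prime_set R].
HB.instance Definition _ (R : comNzRingType) := [Choice of prime_ideals R by <:].

Definition prime_mem (R : comNzRingType) (p : prime_ideals R) : R -> bool :=
  fun x => x \in prime_set p.

Lemma prime_mem_idealr (R : comNzRingType) (p : prime_ideals R) :
  idealr_closed (prime_mem p).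
Proof. by case: p => p hp; case/asboolP: (hp). Qed.

HB.instance Definition _ (R : comNzRingType) (p : prime_ideals R) :=
  isIdealr.Build R (prime_mem p) (@prime_mem_idealr R p).

Definition residue (R : comNzRingType) (p : prime_ideals R) : comNzRingType :=
  {ideal_quot (prime_mem p : idealr R)}.

(* Nonzero, not necessarily proper. *)
Definition is_nonzero_ideal (R : comNzRingType) (I : set R) : Prop :=
  [/\ 0 \in I, {in I &, forall x y, x + y \in I},
      (forall a, {in I, forall x, a * x \in I})
    & exists2 x, x \in I & x != 0].

Record ideals (R : comNzRingType) :=
  MkIdeal { ideal_set : set R; idealP : `[< is_nonzero_ideal ideal_set >] }.
HB.instance Definition _ (R : comNzRingType) := [isSub for @ideal_set R].
HB.instance Definition _ (R : comNzRingType) := [Choice of ideals R by <:].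

Definition ideal_mul (R : comNzRingType) (I J : set R) : set R :=
  [set x | exists2 s : seq (R * R),
     (forall u, u \in s -> I u.1 /\ J u.2) & x = \sum_(u <- s) u.1 * u.2].

Definition ideal_exp (R : comNzRingType) (I : set R) (n : nat) : set R :=
  iter n (ideal_mul I) [set: R].

(** * Rings of integers and residue degrees *)

Definition integral_pred (K : fieldExtType rat) : {pred K} :=
  fun x => `[< integralOver (intr : int -> K) x >].
Arguments integral_pred : clear implicits.

Lemma integral_subring_closed (K : fieldExtType rat) :
  subring_closed (integral_pred K).
Proof.
split.
- by apply/asboolP/integral1.
- by move=> x y /asboolP hx /asboolP hy; apply/asboolP/integral_sub.
- by move=> x y /asboolP hx /asboolP hy; apply/asboolP/integral_mul.
Qed.

HB.instance Definition _ (K : fieldExtType rat) :=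
  GRing.isSubringClosed.Build K (integral_pred K) (@integral_subring_closed K).

Record integers (K : fieldExtType rat) :=
  MkInteger { integer_val : K; integer_valP : integer_val \in integral_pred K }.
HB.instance Definition _ (K : fieldExtType rat) := [isSub for @integer_val K].
HB.instance Definition _ (K : fieldExtType rat) := [Choice of integers K by <:].
HB.instance Definition _ (K : fieldExtType rat) :=
  [SubChoice_isSubComNzRing of integers K by <:].

Lemma integer_emb_subproof (K L : fieldExtType rat) (i : {rmorphism K -> L})
  (x : integers K) : i (integer_val x) \in integral_pred L.
Proof.
apply/asboolP; case: x => /= x /asboolP [P Pmonic Proot]; exists P => //.
suff -> : map_poly (intr : int -> L) P = map_poly i (map_poly intr P).
  exact: rmorph_root.
by apply/polyP=> k; rewrite !coef_map /= rmorph_int.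
Qed.

Definition integer_emb (K L : fieldExtType rat) (i : {rmorphism K -> L})
  (x : integers K) : integers L := MkInteger (integer_emb_subproof i x).

Definition contraction (K L : fieldExtType rat) (i : {rmorphism K -> L})
  (p : prime_ideals (integers L)) : set (integers K) :=
  [set x | integer_emb i x \in prime_set p].

Lemma contraction_prime (K L : fieldExtType rat) (i : {rmorphism K -> L})
  (p : prime_ideals (integers L)) : `[< is_prime_ideal (contraction i p) >].
Proof.
have embE x : integer_val (integer_emb i x) = i (integer_val x) by [].
have contE x : (x \in contraction i p) = (integer_emb i x \in prime_set p).
  by apply/idP/idP => [/set_mem|hx] //; exact/mem_set.
have emb0 : integer_emb i 0 = 0 by apply: val_inj; rewrite /= raddf0.
have emb1 : integer_emb i 1 = 1 by apply: val_inj; rewrite /= rmorph1.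
have embD x y : integer_emb i (x + y) = integer_emb i x + integer_emb i y.
  by apply: val_inj; rewrite /= rmorphD.
have embM x y : integer_emb i (x * y) = integer_emb i x * integer_emb i y.
  by apply: val_inj; rewrite /= rmorphM.
case: p contE => p hp /= contE; case/asboolP: (hp) => -[p0 p1 pD] pM [x xp x0].
apply/asboolP; split; first split.
- by rewrite contE emb0.
- by rewrite contE emb1.
- by move=> a u v; rewrite !contE embD embM; exact: pD.
- by move=> u v; rewrite !contE embM; exact: pM.
have hpM a u : u \in p -> a * u \in p.
  by move=> up; rewrite -[_ * _]addr0; exact: pD.
have: integralOver (intr : int -> L) (integer_val x).
  by apply/asboolP; exact: integer_valP.
case=> P Pmonic; have: P != 0 by exact: monic_neq0.
have vx0 : integer_val x != 0 by rewrite -[0]/(val (0 : integers L)) val_eqE.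
elim/poly_ind: P {Pmonic} => [|P c IH]; first by rewrite eqxx.
have [->|c0] := eqVneq c 0.
  rewrite polyC0 addr0 => PX0; have P0 : P != 0.
    by apply: contraNneq PX0 => ->; rewrite mul0r.
  rewrite rmorphM /= map_polyX rootM => /orP[/(IH P0) //|].
  by rewrite rootX (negPf vx0).
move=> _ rt.
have intE (M : fieldExtType rat) (n : int) :
    integer_val (n%:~R : integers M) = n%:~R.
  exact: (rmorph_int (\val : integers M -> M)).
exists (c%:~R : integers K); last first.
  rewrite -(inj_eq val_inj) /= intE -(rmorph_int (in_alg K)).
  by rewrite fmorph_eq0 intr_eq0.
rewrite contE.
have Pint : (map_poly intr P).[integer_val x] \in integral_pred L.
  apply/asboolP/integral_horner; last by apply/asboolP; exact: integer_valP.
  by apply/integral_poly=> k; rewrite coef_map; exact: integral_id.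
suff -> : integer_emb i c%:~R = - MkInteger Pint * x by exact: hpM.
apply: val_inj; rewrite /= intE rmorph_int.
move: rt; rewrite rmorphD rmorphM /= map_polyX map_polyC /= => /rootP.
by rewrite !hornerE => /eqP; rewrite addrC addr_eq0 => /eqP->; rewrite mulNr.
Qed.

(* The prime q of K below p, i.e. the one such that p lies over q. *)
Definition prime_below (K L : fieldExtType rat) (i : {rmorphism K -> L})
  (p : prime_ideals (integers L)) : prime_ideals (integers K) :=
  MkPrime (contraction_prime i p).

(* The ring homomorphism O_K/q -> O_L/p induced by O_K -> O_L. *)
Definition residue_emb (K L : fieldExtType rat) (i : {rmorphism K -> L})
  (p : prime_ideals (integers L)) (u : residue (prime_below i p)) : residue p :=
  \pi_(residue p)%qT (integer_emb i (generic_quotient.repr u)).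

(* O_L/p has a basis of n elements over O_K/q. *)
Definition has_residue_dim (K L : fieldExtType rat) (i : {rmorphism K -> L})
  (p : prime_ideals (integers L)) (n : nat) : Prop :=
  exists b : 'I_n -> residue p, forall y : residue p,
    exists! c : {ffun 'I_n -> residue (prime_below i p)},
      y = \sum_(j < n) residue_emb (c j) * b j.

(* f(p | q); the dimension always exists and is unique, as residue fields are
   finite, so the default value 0 is never taken. *)
Definition residue_degree (K L : fieldExtType rat) (i : {rmorphism K -> L})
  (p : prime_ideals (integers L)) : nat :=
  xget 0%N [set n | has_residue_dim i p n].

(** * Arithmetic symmetric functions *)

(* The variable x_j^(q) is the pair (q, j), with j counted from 0. *)
Notation monomial K := {cmonom (prime_ideals (integers K) * nat)%type}.

(* Formal power series in all the variables. *)
Definition power_series (K : fieldExtType rat) := monomial K -> Qab.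

Definition series_const (K : fieldExtType rat) (c : Qab) : power_series K :=
  fun m => if m == mone then c else 0.

Definition series_add (K : fieldExtType rat) (F G : power_series K) :
    power_series K :=
  fun m => F m + G m.

Definition series_mul (K : fieldExtType rat) (F G : power_series K) :
    power_series K :=
  fun m => \sum_(u \in [set u : monomial K * monomial K | mmul u.1 u.2 = m])
    F u.1 * G u.2.

(* Symmetric functions (bounded degree, invariant under permutations of the
   variables) in the alphabet X^(q). As F only involves this alphabet, it does
   no harm that s permutes the variables of all alphabets. *)
Definition sym_function (K : fieldExtType rat) (q : prime_ideals (integers K))
    (F : power_series K) : Prop :=
  [/\ exists d : nat, forall m, F m != 0 -> (mdeg m <= d)%N,
      forall m, F m != 0 -> forall r j, m (r, j) != 0%N -> r = q
    & forall s : nat -> nat, bijective s ->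
        forall m m' : monomial K,
          (forall r j, m' (r, s j) = m (r, j)) -> F m' = F m].

(* A_K. The tensor product of the rings of symmetric functions, over finite
   sets of alphabets, is realized as usual by multiplying out: it is the
   subalgebra of the power series generated by the symmetric functions in the
   various alphabets. *)
Inductive sym_tensor (K : fieldExtType rat) : power_series K -> Prop :=
| SymTensorConst c : sym_tensor (@series_const K c)
| SymTensorSym q F of sym_function q F : sym_tensor F
| SymTensorAdd F G of sym_tensor F & sym_tensor G :
    sym_tensor (series_add F G)
| SymTensorMul F G of sym_tensor F & sym_tensor G :
    sym_tensor (series_mul F G).

(* The degrees of a monomial in the various alphabets. *)
Definition multidegree (K : fieldExtType rat) (m : monomial K) :
    {fsfun prime_ideals (integers K) -> nat with 0%N} :=
  [fsfun q in [fset v.1 | v in finsupp m]%fset =>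
     (\sum_(v <- finsupp m | v.1 == q) m v)%N].

Definition prime_power_prod (K : fieldExtType rat)
    (d : {fsfun prime_ideals (integers K) -> nat with 0%N}) : set (integers K) :=
  \big[@ideal_mul _/[set: integers K]]_(q <- finsupp d)
    ideal_exp (prime_set q) (d q).

Definition homogeneous (K : fieldExtType rat) (a : ideals (integers K))
    (F : power_series K) : Prop :=
  exists2 d : {fsfun prime_ideals (integers K) -> nat with 0%N},
    ideal_set a = prime_power_prod d
  & forall m, F m != 0 -> multidegree m = d.

(* The ring of arithmetic symmetric functions: a formal sum of F_a, a in J_K^+,
   is encoded as the family of its terms. *)
Definition formal_sum (K : fieldExtType rat) :=
  ideals (integers K) -> power_series K.

Definition arith_sym (K : fieldExtType rat) : set (formal_sum K) :=
  [set F | forall a, sym_tensor (F a) /\ homogeneous a (F a)].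
Arguments arith_sym : clear implicits.

(** * The norm map *)

(* x_j^(p) |-> (x_j^(q))^f(p|q), for p over q. *)
Definition norm_monomial (K L : fieldExtType rat) (i : {rmorphism K -> L})
    (m : monomial L) : monomial K :=
  \big[mmul/mone]_(v <- finsupp m)
    expcmn (ucm (prime_below i v.1, v.2)) (residue_degree i v.1 * m v)%N.

(* The substitution, extended to infinite sums: the coefficient of m is the sum
   of the coefficients of the monomials mapped to m, which are finitely many as
   there are finitely many primes over q and residue degrees are positive. *)
Definition norm_series (K L : fieldExtType rat) (i : {rmorphism K -> L})
    (F : power_series L) : power_series K :=
  fun m => \sum_(n \in [set n : monomial L | norm_monomial i n = m]) F n.

(* N_{L/K} of the formal sum of the F_a is the formal sum of the norms of the
   F_a, regrouped by degree: its term of degree b consists of the monomials of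
   degree b in the sum over all a of the [norm_series i (F a)]. *)
Definition norm_map (K L : fieldExtType rat) (i : {rmorphism K -> L})
    (F : formal_sum L) : formal_sum K :=
  fun b m =>
    if prime_power_prod (multidegree m) == ideal_set b
    then \sum_(a \in [set: ideals (integers L)]) norm_series i (F a) m
    else 0.

(* Main.v *)
(* The residue degree is determined by #(O_L/p) = #(O_K/q)^f, so it is
   multiplicative in towers, and by this the substitutions on monomials compose.
   What remains is that the infinite sums may be regrouped: every monomial of
   A_K is the image of finitely many monomials of A_E, as there are finitely
   many primes over q and f > 0.  All finiteness comes from O_K/pO_K being
   finite for a rational prime p: elements of O_K that are independent modulo p
   are independent over Q, so a longest such family generates O_K modulo p. *)
Require Import Defs.
From mathcomp Require Import all_boot all_order all_algebra all_fingroup all_field.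
From mathcomp Require Import mathcomp_extra boolp classical_sets.
From HB Require Import structures.
From mathcomp Require Import finmap functions cardinality fsbigop.
From mathcomp.multinomials Require Import monalg.
From mathcomp Require Import zify ring.

Set Implicit Arguments.
Unset Strict Implicit.
Unset Printing Implicit Defensive.

Import Order.TTheory GRing.Theory Num.Theory.
Local Open Scope ring_scope.
Local Open Scope classical_set_scope.

(** * Counting *)

(** Residue rings carry no [finType] structure, so their cardinality is expressed by a bijection
    with an ordinal type. *)
Definition has_card (T : Type) (n : nat) := exists f : T -> 'I_n, bijective f.

Lemma has_card_leq (S T : Type) (m n : nat) (f : S -> T) :
  has_card S m -> has_card T n -> injective f -> (m <= n)%N.
Proof.
move=> [g [g' gK g'K]] [h hbij] finj.
suff : injective (h \o f \o g') by move/leq_card; rewrite !card_ord.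
exact: inj_comp (inj_comp (bij_inj hbij) finj) (can_inj g'K).
Qed.

Lemma has_card_bij (S T : Type) (n : nat) (f : S -> T) :
  has_card T n -> bijective f -> has_card S n.
Proof. by move=> [g gbij] fbij; exists (g \o f); exact: bij_comp. Qed.

Lemma has_card_uniq (T : Type) (m n : nat) :
  has_card T m -> has_card T n -> m = n.
Proof.
by move=> Tm Tn; apply/eqP; rewrite eqn_leq !(@has_card_leq T T _ _ idfun).
Qed.

Lemma has_card_finType (T : finType) : has_card T #|T|.
Proof. by exists enum_rank; exact: enum_rank_bij. Qed.

Lemma has_card_surj (S : finType) (T : choiceType) (f : S -> T) :
  (forall y, exists x, y = f x) -> exists n, has_card T n.
Proof.
move=> fsurj; pose s := undup (map f (enum S)); exists (size s).
have sT y : y \in s.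
  by have [x ->] := fsurj y; rewrite mem_undup map_f ?mem_enum.
have lt y : (index y s < size s)%N by rewrite index_mem.
exists (fun y => Ordinal (lt y)); exists (fun k => tnth (in_tuple s) k).
  by move=> y; rewrite (tnth_nth y) /= nth_index.
move=> k; apply: val_inj; rewrite /= (tnth_nth (tnth (in_tuple s) k)) /=.
by rewrite index_uniq ?undup_uniq.
Qed.

Lemma has_card_ffun (T : Type) (q n : nat) :
  has_card T q -> has_card {ffun 'I_n -> T} (q ^ n).
Proof.
move=> [g [g' gK g'K]].
have := has_card_finType {ffun 'I_n -> 'I_q}.
rewrite card_ffun !card_ord.
move/has_card_bij
  => /(_ _ (fun c : {ffun 'I_n -> T} => [ffun j => g (c j)] : {ffun 'I_n -> 'I_q})).
apply.
exists (fun c : {ffun 'I_n -> 'I_q} => [ffun j => g' (c j)] : {ffun 'I_n -> T});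
  move=> c; apply/ffunP=> j; rewrite !ffunE.
  exact: gK.
exact: g'K.
Qed.

Lemma has_card_inj_surj (T : Type) (n : nat) (f : T -> T) :
  has_card T n -> injective f -> forall y, exists x, f x = y.
Proof.
move=> [g [g' gK g'K]] finj y.
have hinj : injective (g \o f \o g').
  exact: inj_comp (inj_comp (can_inj gK) finj) (can_inj g'K).
exists (g' (invF hinj (g y))); apply: (can_inj gK).
exact: (f_invF hinj).
Qed.

Lemma has_card_gt1 (R : nzRingType) (n : nat) : has_card R n -> (1 < n)%N.
Proof.
move=> Rn; have: has_card bool 2 by rewrite -card_bool; exact: has_card_finType.
move/has_card_leq=> /(_ _ _ (fun b : bool => b%:R : R) Rn); apply.
by case=> -[] //= /eqP; rewrite ?oner_eq0 // eq_sym oner_eq0.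
Qed.

(** * Bases and cardinalities of finite rings *)

Section FiniteBasis.

Variables (R S : comNzRingType) (f : {rmorphism R -> S}) (q N : nat).
Hypotheses (Rq : has_card R q) (SN : has_card S N).

Let comb n (b : 'I_n -> S) (c : {ffun 'I_n -> R}) := \sum_(j < n) f (c j) * b j.

(** Taking coordinates is a bijection from [S] onto the [n]-tuples over [R]. *)
Lemma card_basis n (b : 'I_n -> S) :
  (forall y, exists! c : {ffun 'I_n -> R}, y = \sum_(j < n) f (c j) * b j) ->
  N = (q ^ n)%N.
Proof.
move=> bP; pose coef y := sval (cid (bP y)).
have coefP y : y = comb b (coef y) by rewrite /coef; case: cid => c [].
have coef_uniq y c : y = comb b c -> coef y = c.
  by rewrite /coef; case: cid => c' /= [_ h] /h.
apply: (has_card_uniq SN).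
apply: (@has_card_bij _ _ _ coef (has_card_ffun n Rq)); exists (comb b) => //.
by move=> c; exact: coef_uniq.
Qed.

(* The coordinate map of a family of n elements, if injective, gives
   2^n <= #S; a longest family with injective coordinate map also spans. *)
Lemma finite_basis : (forall x : R, x != 0 -> exists y, y * x = 1) ->
  exists n (b : 'I_n -> S), forall y,
    exists! c : {ffun 'I_n -> R}, y = \sum_(j < n) f (c j) * b j.
Proof.
move=> Rinv; pose P n := exists b : 'I_n -> S, injective (comb b).
have P0 : exists n, `[< P n >].
  exists 0%N; apply/asboolP; exists (fun=> 0) => c c' _.
  by apply/ffunP; case.
have Pbound n : `[< P n >] -> (n <= N)%N.
  move=> /asboolP[b /(has_card_leq (has_card_ffun n Rq) SN)].
  by apply: leq_trans; rewrite ltnW // ltn_expl // (has_card_gt1 Rq).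
case: (ex_maxnP P0 Pbound) => n /asboolP[b binj] nmax; exists n, b => y.
suff [c yE] : exists c, y = comb b c.
  by exists c; split=> // c' yE'; apply: binj; rewrite -yE.
apply: contrapT => ynot.
suff: P n.+1 by move/asboolP/nmax; rewrite ltnn.
(* If [y] were not spanned, prepending it would give a longer independent family. *)
exists (fun j => if unlift ord0 j is Some k then b k else y) => c c'.
rewrite /comb !big_ord_recl !unlift_none.
pose tl (e : {ffun 'I_n.+1 -> R}) := [ffun j => e (lift ord0 j)] : {ffun 'I_n -> R}.
have tlE (e : {ffun 'I_n.+1 -> R}) : \sum_(j < n) f (e (lift ord0 j)) *
    (if unlift ord0 (lift ord0 j) is Some k then b k else y) = comb b (tl e).
  by apply: eq_bigr => j _; rewrite liftK ffunE.
rewrite !tlE => eqcc'.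
have combB e e' : comb b e - comb b e' = comb b [ffun j => e j - e' j].
  rewrite /comb -sumrB; apply: eq_bigr => j _.
  by rewrite ffunE rmorphB mulrBl.
have eqB : f (c ord0 - c' ord0) * y = comb b [ffun j => tl c' j - tl c j].
  rewrite -combB rmorphB mulrBl -[X in X - _](addrK (comb b (tl c))) eqcc'.
  by rewrite addrAC [_ * y + _]addrC addrK.
(* A nonzero difference of leading coefficients could be inverted, putting [y] in the span of
   [b]. *)
have c0 : c ord0 = c' ord0.
  apply/eqP; rewrite -subr_eq0; apply/negP => /negP/Rinv[u uK].
  apply: ynot; exists [ffun j => u * [ffun j => tl c' j - tl c j] j].
  rewrite -[y]mul1r -(rmorph1 f) -uK rmorphM -mulrA eqB /comb mulr_sumr.
  by apply: eq_bigr => j _; rewrite mulrA -rmorphM [in RHS]ffunE.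
have : tl c = tl c' by apply: binj; move: eqcc'; rewrite c0 => /addrI.
move=> eqtl; apply/ffunP=> j; have [k ->|->] := unliftP ord0 j; last by [].
by have /ffunP/(_ k) := eqtl; rewrite !ffunE.
Qed.

End FiniteBasis.

(** * Integers modulo a rational prime *)

Section IntegersModPrime.

Variable K : fieldExtType rat.
Notation O := (integers K).

(** [O] is torsion-free because it lies in a rational vector space. *)
Lemma integer_intr_eq0 (n : int) (x : O) : n%:~R * x = 0 -> (n == 0) || (x == 0).
Proof.
move=> nx0; have : n%:~R *: val x = 0 :> K.
  by rewrite scaler_int -mulrzl -(rmorph_int (val : O -> K)) -rmorphM nx0 rmorph0.
by move/eqP; rewrite scaler_eq0 intr_eq0.
Qed.

Lemma integer_mulIr (n : int) (x y : O) :
  n != 0 -> n%:~R * x = n%:~R * y -> x = y.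
Proof.
move=> n0 /eqP; rewrite -subr_eq0 -mulrBr => /eqP /integer_intr_eq0.
by rewrite (negPf n0) subr_eq0 => /eqP.
Qed.

Variables (p : nat) (p_prime : prime p).

(** Linear independence over F_p of the images in O/pO, with integer coefficients so that relations
    can be divided by [p]. *)
Definition independent_mod k (x : 'I_k -> O) := forall c : 'I_k -> int,
  (exists z, \sum_(j < k) (c j)%:~R * x j = p%:R * z) ->
  forall j, (p %| c j)%Z.

Let p_neq0 : p%:Z != 0.
Proof. by have := prime_gt0 p_prime; lia. Qed.

(* The coefficients of a relation are divisible by p; dividing it by p again
   and again, they are divisible by all powers of p. *)
Lemma independent_mod_int_relation k (x : 'I_k -> O) (c : 'I_k -> int) :
  independent_mod x -> \sum_(j < k) (c j)%:~R * x j = 0 -> forall j, c j = 0.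
Proof.
move=> xind c0; have dvd_pX m j : (p%:Z ^+ m %| c j)%Z.
  elim: m c c0 j => [|m IHm] c c0 j; first by rewrite expr0 dvd1z.
  have pc i : (p %| c i)%Z by apply: xind; exists 0; rewrite c0 mulr0.
  rewrite exprS mulrC -(divzK (pc j)); apply: dvdz_mul => //.
  apply: (IHm (fun i => (c i %/ p)%Z)).
  apply: (@integer_mulIr p%:Z) => //; rewrite mulr0 mulr_sumr -[RHS]c0.
  by apply: eq_bigr => i _; rewrite /= mulrA -intrM [p%:Z * _]mulrC divzK.
move=> j; apply/eqP/negPn/negP => cj.
(* The exponent |c_j| is large enough: p^m > m, so p^|c_j| cannot divide a nonzero c_j. *)
have := dvd_pX `|c j|%N j; rewrite dvdzE abszX /=.
move/dvdn_leq; rewrite absz_gt0 cj => /(_ isT); apply/negP.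
by rewrite -ltnNge ltn_expl // prime_gt1.
Qed.

(** Multiplying a rational relation by the product of its denominators gives an integral one, whose
    coefficients vanish. *)
Lemma independent_mod_dim k (x : 'I_k -> O) :
  independent_mod x -> (k <= \dim {:K})%N.
Proof.
move=> xind; pose X := [tuple val (x j) | j < k].
suff Xfree : free X.
  by move/eqP: Xfree; rewrite size_tuple => <-; exact/dimvS/subvf.
apply/freeP => a a0; pose c j : int := numq (a j) * \prod_(i | i != j) denq (a i).
have cE j : (c j)%:~R = (\prod_i denq (a i))%:~R * a j.
  by rewrite [in RHS](bigD1 j) //= !intrM numqE mulrAC mulrC [a j * _]mulrC mulrA.
have c0 : \sum_(j < k) (c j)%:~R * x j = 0.
  apply: val_inj; rewrite [LHS](rmorph_sum (val : O -> K)) rmorph0.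
  rewrite -[RHS](scaler0 _ (\prod_i denq (a i))%:~R) -[in RHS]a0 scaler_sumr.
  apply: eq_bigr => i _; rewrite rmorphM rmorph_int mulrzl -scaler_int cE.
  by rewrite scalerA -tnth_nth tnth_mktuple.
move=> j; have /eqP := independent_mod_int_relation xind c0 j.
rewrite -(intr_eq0 rat) cE mulf_eq0 intr_eq0 => /orP[|/eqP //].
by rewrite prodf_seq_eq0 => /hasP[i _ /=]; rewrite (negPf (denq_neq0 _)).
Qed.

(** Adding [y] to a longest family independent modulo [p] produces a relation whose coefficient at
    [y] is invertible modulo [p]. Coefficients in ['I_p] leave only finitely many combinations. *)
Lemma integers_mod_generated : exists k (x : 'I_k -> O), forall y : O,
  exists (c : {ffun 'I_k -> 'I_p}) z, y = \sum_(j < k) (c j)%:R * x j + p%:R * z.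
Proof.
pose P k := exists x : 'I_k -> O, independent_mod x.
have P0 : exists k, `[< P k >].
  by exists 0%N; apply/asboolP; exists (fun=> 0) => c _ [].
have Pbound k : `[< P k >] -> (k <= \dim {:K})%N.
  by move=> /asboolP[x]; exact: independent_mod_dim.
case: (ex_maxnP P0 Pbound) => k /asboolP[x xind] kmax; exists k, x => y.
have red (c : 'I_k -> int) : exists (c' : {ffun 'I_k -> 'I_p}) z,
    \sum_(j < k) (c j)%:~R * x j = \sum_(j < k) (c' j)%:R * x j + p%:R * z.
  have lt j : (`|(c j %% p)%Z| < p)%N.
    by have := ltz_mod (c j) p_neq0; have := modz_ge0 (c j) p_neq0; lia.
  exists [ffun j => Ordinal (lt j)], (\sum_(j < k) (c j %/ p)%Z%:~R * x j).
  rewrite mulr_sumr -big_split /=; apply: eq_bigr => j _.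
  rewrite ffunE /= mulrA -mulrDl; congr (_ * _).
  rewrite {1}(divz_eq (c j) p) intrD intrM addrC [in RHS]mulrC; congr (_ + _).
  by rewrite -[in LHS](gez0_abs (modz_ge0 (c j) p_neq0)).
have /existsNP[c] : ~ independent_mod
    (fun j => if unlift ord0 j is Some i then x i else y).
  move=> yind; have /asboolP/kmax : P k.+1 by eexists; exact: yind.
  by rewrite ltnn.
move=> /not_implyP[[z]].
rewrite big_ord_recl unlift_none; under eq_bigr do rewrite liftK.
move=> cz /existsNP[j pc].
(* Otherwise the term in [y] could be absorbed into [p%:R * z], and independence of [x] would make
   all coefficients divisible by [p]. *)
have pc0 : ~~ (p %| c ord0)%Z.
  apply/negP=> /dvdzP[d c0E]; apply: pc.
  have [i ->|->] := unliftP ord0 j; last by rewrite c0E dvdz_mull.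
  move: i; apply: xind; exists (z - d%:~R * y).
  rewrite mulrBr -cz c0E intrM mulrA [p%:R * _]mulrC addrAC subrr add0r.
  by [].
have /coprimezP[[u v] /= uv] : coprimez (c ord0) p.
  by rewrite coprimezE coprime_sym prime_coprime.
(* Bezout: y = (u c_0 + v p) y, and c_0 y is an x-combination modulo p. *)
have [c' [w red']] := red (fun i => - u * c (lift ord0 i)).
exists c', (w + u%:~R * z + v%:~R * y).
rewrite !mulrDr !addrA -red'.
have -> : \sum_(i < k) (- u * c (lift ord0 i))%:~R * x i =
    - u%:~R * \sum_(i < k) (c (lift ord0 i))%:~R * x i.
  by rewrite mulr_sumr; apply: eq_bigr => i _; rewrite intrM intrN mulrA.
have yE : y = (u%:~R * (c ord0)%:~R + v%:~R * p%:R) * y.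
  by rewrite -[p%:R]/(p%:~R) -!intrM -intrD uv mul1r.
have c0E : (c ord0)%:~R * y = p%:R * z - \sum_(i < k) (c (lift ord0 i))%:~R * x i.
  by rewrite -cz addrK.
rewrite {1}yE mulrDl -mulrA c0E; ring.
Qed.

End IntegersModPrime.

(** * Primes and residue degrees *)

Lemma finite_set_injl (T : Type) (U : finType) (A : set T) (f : T -> U) :
  {in A &, injective f} -> finite_set A.
Proof.
by move=> finj; rewrite -(eq_finite_set (inj_card_eq finj)); exact: finite_finset.
Qed.

Section Embedding.

Variables (K L : fieldExtType rat) (i : {rmorphism K -> L}).

Fact integer_emb_is_zmod_morphism : zmod_morphism (integer_emb i).
Proof. by move=> x y; apply: val_inj; rewrite /= rmorphB. Qed.

Fact integer_emb_is_monoid_morphism : monoid_morphism (integer_emb i).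
Proof.
by split=> [|x y]; apply: val_inj; rewrite /= ?rmorph1 ?rmorphM.
Qed.

HB.instance Definition _ := GRing.isZmodMorphism.Build
  (integers K) (integers L) (integer_emb i) integer_emb_is_zmod_morphism.
HB.instance Definition _ := GRing.isMonoidMorphism.Build
  (integers K) (integers L) (integer_emb i) integer_emb_is_monoid_morphism.

Variable P : prime_ideals (integers L).

Lemma prime_below_mem (x : integers K) :
  (x \in prime_mem (prime_below i P)) = (integer_emb i x \in prime_mem P).
Proof. by apply/idP/idP => [/set_mem|] //; exact: mem_set. Qed.

End Embedding.

Lemma prime_below_comp (K L E : fieldExtType rat)
    (i : {rmorphism K -> L}) (j : {rmorphism L -> E})
    (P : prime_ideals (integers E)) :
  prime_below (j \o i) P = prime_below i (prime_below j P).
Proof.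
apply: val_inj; apply/predeqP => x /=.
rewrite /contraction /=.
have -> : integer_emb (j \o i) x = integer_emb j (integer_emb i x) by exact: val_inj.
by split=> [h|/set_mem//]; exact: mem_set.
Qed.

(** * Residue rings of prime ideals *)

Section Residue.

Variables (R : comNzRingType) (P : prime_ideals R).

Definition to_residue (x : R) : residue P := \pi_(residue P)%qT x.

Lemma to_residue_surj (y : residue P) : exists x, y = to_residue x.
Proof. by exists (generic_quotient.repr y); rewrite /to_residue reprK. Qed.

Fact to_residue_is_zmod_morphism : zmod_morphism to_residue.
Proof. by move=> x y; rewrite /to_residue rmorphB. Qed.

Fact to_residue_is_monoid_morphism : monoid_morphism to_residue.
Proof. by split=> [|x y]; rewrite /to_residue ?rmorph1 ?rmorphM. Qed.

HB.instance Definition _ := GRing.isZmodMorphism.Build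
  R (residue P) to_residue to_residue_is_zmod_morphism.
HB.instance Definition _ := GRing.isMonoidMorphism.Build
  R (residue P) to_residue to_residue_is_monoid_morphism.

Lemma to_residue_eq0 x : (to_residue x == 0) = (x \in prime_mem P).
Proof.
rewrite -(rmorph0 to_residue) -[in RHS](subr0 x).
exact: esym (Quotient.idealrBE (prime_mem P : idealr R) x 0).
Qed.

(** This is the primality of [P], stated by hand since [residue P] is declared only as a commutative
    ring. *)
Lemma residue_domain (x y : residue P) : x * y = 0 -> (x == 0) || (y == 0).
Proof.
have [u ->] := to_residue_surj x; have [v ->] := to_residue_surj y.
move/eqP; rewrite -rmorphM !to_residue_eq0.
by case: (P) => p hp /=; case/asboolP: (hp) => _ pM _; exact: pM.
Qed.

(** Multiplication by [x] is injective, hence surjective on a finite set. *)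
Lemma residue_inverse n (x : residue P) :
  has_card (residue P) n -> x != 0 -> exists y, y * x = 1.
Proof.
move=> Pn x0; apply: (has_card_inj_surj (f := *%R^~ x) Pn).
move=> u v /eqP; rewrite -subr_eq0 -mulrBl => /eqP/residue_domain.
by rewrite (negPf x0) orbF subr_eq0 => /eqP.
Qed.

End Residue.

(** * Rational primes in prime ideals, and finiteness *)

Section RationalPrimeBelow.

Variables (K : fieldExtType rat) (P : prime_ideals (integers K)).

Lemma prime_ideal_natural : exists2 n : nat, (0 < n)%N & n%:R \in prime_mem P.
Proof.
(* The contraction of P to the integers of Q is a nonzero prime ideal. *)
pose i : {rmorphism rat^o -> K} := in_alg K.
have /asboolP[_ _ [x xP x0]] := contraction_prime i P.
set r := integer_val x; have r0 : (r : rat) != 0 by [].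
(* The numerator of [r] is its denominator times [x], so it maps into [P]; the sign is removed at
   the end. *)
exists `|numq r|%N; first by rewrite absz_gt0 numq_eq0.
have rE : (denq r)%:~R * x = (numq r)%:~R.
  apply: val_inj; rewrite rmorphM !rmorph_int [RHS]numqE mulrC.
  by [].
have numP : (numq r)%:~R \in prime_mem P.
  rewrite -(rmorph_int (integer_emb i)) -rE rmorphM idealMr //.
  exact: (set_mem xP).
by case: (intP (numq r)) numP => [//|n|n]; rewrite ?rmorphN ?rpredN.
Qed.

(** The least positive [n] in [P] works: writing it as [m * pdiv n], one factor lies in [P], and by
    minimality this must be [pdiv n], equal to [n]. *)
Lemma prime_ideal_prime : exists2 p : nat, prime p & p%:R \in prime_mem P.
Proof.
have ex : exists n : nat, (0 < n)%N && (n%:R \in prime_mem P).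
  by have [n n0 nP] := prime_ideal_natural; exists n; rewrite n0.
case: (ex_minnP ex) => n /andP[n0 nP] nmin.
have n1 : (1 < n)%N.
  case: n n0 nP {nmin} => [//|[|//]] _.
  by rewrite (@idealr1 _ (prime_mem P : idealr _)).
exists n => //; have pn := pdiv_prime n1.
have [m nE] := dvdnP (pdiv_dvd n).
have : (m%:R \in prime_mem P) || ((pdiv n)%:R \in prime_mem P).
  have /asboolP[_ pM _] := Defs.primeP P; apply: pM.
  by rewrite -natrM -nE.
have m0 : (0 < m)%N by rewrite lt0n; apply: contraTneq n0 => m0; rewrite nE m0.
case/orP => [mP|pP].
  have : (n <= m)%N by apply: nmin; rewrite m0.
  by rewrite leqNgt {1}nE ltn_Pmulr // prime_gt1.
suff -> : n = pdiv n by [].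
by apply/eqP; rewrite eqn_leq pdiv_leq ?nmin ?pdiv_gt0.
Qed.

(** As [P] contains some prime [p], the finitely many representatives modulo [p] already meet every
    class modulo [P]. *)
Lemma residue_finite : exists n, has_card (residue P) n.
Proof.
have [p p_prime pP] := prime_ideal_prime.
have [k [x xgen]] := integers_mod_generated K p_prime.
apply: (@has_card_surj {ffun 'I_k -> 'I_p} _
  (fun c => to_residue P (\sum_(j < k) (c j)%:R * x j))) => y.
have [z ->] := to_residue_surj y; have [c [w ->]] := xgen z; exists c.
apply/eqP; rewrite -subr_eq0 -rmorphB to_residue_eq0 addrAC subrr add0r mulrC.
exact: idealMr.
Qed.

End RationalPrimeBelow.

(** All primes over [q] contain a common rational prime [p], so each is determined by which of the
    finitely many representatives modulo [p] it contains. *)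
Lemma finite_primes_above (K L : fieldExtType rat) (i : {rmorphism K -> L})
    (q : prime_ideals (integers K)) :
  finite_set [set P | prime_below i P = q].
Proof.
have [p p_prime pq] := prime_ideal_prime q.
have [k [x xgen]] := integers_mod_generated L p_prime.
pose f (P : prime_ideals (integers L)) : {ffun {ffun 'I_k -> 'I_p} -> bool} :=
  [ffun c : {ffun 'I_k -> 'I_p} => \sum_(j < k) (c j)%:R * x j \in prime_mem P].
apply: (@finite_set_injl _ _ _ f) => P Q /set_mem /= Pq /set_mem /= Qq fPQ.
have p_mem P' : prime_below i P' = q -> p%:R \in prime_mem P'.
  by move=> P'q; rewrite -(rmorph_nat (integer_emb i)) -prime_below_mem P'q.
have memE P' y c w : prime_below i P' = q ->
    y = \sum_(j < k) ((c : {ffun 'I_k -> 'I_p}) j)%:R * x j + p%:R * w ->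
    (y \in prime_mem P') = f P' c.
  move=> P'q ->; rewrite ffunE rpredDr // mulrC.
  by apply: idealMr; exact: p_mem.
apply: val_inj; apply/predeqP => y; have [c [w yE]] := xgen y.
have := memE Q _ _ _ Qq yE; rewrite -fPQ -(memE P _ _ _ Pq yE) => PQ.
rewrite -![_ \in prime_mem _]/(_ \in prime_set _) in PQ.
by split=> /mem_set h; apply: set_mem; [rewrite PQ|rewrite -PQ].
Qed.

(** * The residue degree as an exponent of cardinalities *)

Section ResidueDegree.

Variables (K L : fieldExtType rat) (i : {rmorphism K -> L}).
Variable P : prime_ideals (integers L).
Notation Q := (prime_below i P).

(** The representative chosen in [residue_emb] differs from [x] by an element of [Q], which lands in
    [P]. *)
Lemma residue_emb_to_residue (x : integers K) :
  @residue_emb _ _ i P (to_residue Q x) = to_residue P (integer_emb i x).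
Proof.
apply/eqP; rewrite -subr_eq0 -[residue_emb _]/(to_residue P _) -!rmorphB.
rewrite to_residue_eq0 -prime_below_mem -to_residue_eq0 rmorphB subr_eq0.
exact/eqP/(reprK (to_residue Q x)).
Qed.

Fact residue_emb_is_zmod_morphism : zmod_morphism (@residue_emb _ _ i P).
Proof.
move=> x y; have [u ->] := to_residue_surj x; have [v ->] := to_residue_surj y.
by rewrite -rmorphB !residue_emb_to_residue !rmorphB.
Qed.

Fact residue_emb_is_monoid_morphism : monoid_morphism (@residue_emb _ _ i P).
Proof.
split=> [|x y].
  by rewrite -(rmorph1 (to_residue Q)) residue_emb_to_residue !rmorph1.
have [u ->] := to_residue_surj x; have [v ->] := to_residue_surj y.
by rewrite -rmorphM !residue_emb_to_residue !rmorphM.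
Qed.

HB.instance Definition _ := GRing.isZmodMorphism.Build
  (residue Q) (residue P) (@residue_emb _ _ i P) residue_emb_is_zmod_morphism.
HB.instance Definition _ := GRing.isMonoidMorphism.Build
  (residue Q) (residue P) (@residue_emb _ _ i P) residue_emb_is_monoid_morphism.

(** [finite_basis] provides a basis, so [xget] does not fall back on 0, and counting coordinates
    gives the power. *)
Lemma residue_degreeP q N : has_card (residue Q) q -> has_card (residue P) N ->
  N = (q ^ residue_degree i P)%N.
Proof.
move=> Qq PN.
have dim_ex : exists n, [set n | has_residue_dim i P n] n.
  have [|n [b bP]] := finite_basis (@residue_emb _ _ i P : {rmorphism _ -> _}) Qq PN.
    by move=> x; exact: residue_inverse Qq.
  by exists n; exists b.
have [b bP] := xgetPex 0%N dim_ex.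
exact: (@card_basis _ _ (@residue_emb _ _ i P : {rmorphism _ -> _}) _ _ Qq PN _ b bP).
Qed.

(** Degree 0 would leave a residue ring with one element, where 0 = 1. *)
Lemma residue_degree_gt0 : (0 < residue_degree i P)%N.
Proof.
have [q Qq] := residue_finite Q; have [N PN] := residue_finite P.
rewrite lt0n; apply/eqP => f0; have := residue_degreeP Qq PN.
by rewrite f0 expn0 => N1; have := has_card_gt1 PN; rewrite N1.
Qed.

End ResidueDegree.

(** The top residue ring is counted directly and through the middle one; the exponents agree because
    the bottom one has more than one element. *)
Lemma residue_degree_comp (K L E : fieldExtType rat)
    (i : {rmorphism K -> L}) (j : {rmorphism L -> E})
    (P : prime_ideals (integers E)) :
  residue_degree (j \o i) P =
    (residue_degree i (prime_below j P) * residue_degree j P)%N.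
Proof.
have [q Qq] := residue_finite (prime_below i (prime_below j P)).
have [M QM] := residue_finite (prime_below j P).
have [N PN] := residue_finite P.
have := residue_degreeP QM PN; rewrite (residue_degreeP Qq QM) -expnM.
(* The residue ring below along the composite is a different type, identified only through
   [prime_below_comp]. *)
have Qq' := Qq; rewrite -prime_below_comp in Qq'.
rewrite (residue_degreeP Qq' PN) => /eqP.
by rewrite eqn_exp2l ?(has_card_gt1 Qq) // => /eqP.
Qed.

(** * The norm on monomials and on formal sums *)

(** After turning the fibre condition into zero terms and exchanging the sums, only [j = h k]
    survives for each [k]. *)
Lemma fsbig_fibers (V : nmodType) (I J : choiceType) (A : set I) (B : set J)
    (h : I -> J) (F : I -> V) :
  finite_set A -> finite_set B -> (forall k, A k -> B (h k)) ->
  \sum_(k \in A) F k =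
    \sum_(j \in B) \sum_(k \in A `&` h @^-1` [set j]) F k.
Proof.
move=> Afin Bfin AB; under [RHS]eq_fsbigr do rewrite fsbig_mkcondr.
rewrite exchange_fsbig //; apply: eq_fsbigr => k /set_mem Ak.
rewrite -(fsbig_widen [set h k]) ?fsbig_set1 ?mem_set // => [j -> | j [_ /= jk]].
  exact: AB.
by case: ifPn => // /set_mem /= kj; case: jk.
Qed.

Lemma expcmnE (I : choiceType) (m : {cmonom I}) n i : expcmn m n i = (m i * n)%N.
Proof.
(* The exponent 1 is a case of its own, as [expcmn m 1] unfolds to [m]. *)
elim: n => [|[|n] IHn]; first by rewrite muln0 [LHS]onecmE.
  by rewrite muln1.
by rewrite [expcmn m n.+2]/(mulcm m (expcmn m n.+1)) mulcmE IHn -mulnS.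
Qed.

Section NormMonomial.

Variables (K L : fieldExtType rat) (i : {rmorphism K -> L}).

Definition below_var (v : prime_ideals (integers L) * nat) :
    prime_ideals (integers K) * nat :=
  (prime_below i v.1, v.2).

(** A free choice of [D] above the support makes it possible to exchange sums over sets fixed in
    advance. *)
Lemma norm_monomialE (D : {fset prime_ideals (integers L) * nat})
    (m : monomial L) w :
  (finsupp m `<=` D)%fset -> norm_monomial i m w =
    (\sum_(v <- D) (below_var v == w) * (residue_degree i v.1 * m v))%N.
Proof.
move=> mD; rewrite -(big_fset_incl _ mD); last first.
  by move=> v _ /fsfun_dflt ->; rewrite !muln0.
rewrite /norm_monomial.
rewrite (big_morph (fun n : monomial K => n w) (id1 := 0%N) (op1 := addn)).
- by apply: eq_bigr => v _; rewrite expcmnE ucmE.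
- by move=> a b; exact: cmM.
- exact: cm1.
Qed.

(** Positivity of the residue degree; it bounds the exponents of monomials in a fibre. *)
Lemma norm_monomial_ge (m : monomial L) v :
  (m v <= norm_monomial i m (below_var v))%N.
Proof.
rewrite (norm_monomialE _ (fsubset_refl _)); case: finsuppP => // mv.
rewrite (big_fsetD1 v) //= eqxx mul1n.
by apply: leq_trans (leq_addr _ _); rewrite leq_pmull // residue_degree_gt0.
Qed.

(** A monomial over [m] involves only variables above those of [m], finitely many, with exponents at
    most [mdeg m]. *)
Lemma finite_norm_fiber (m : monomial K) :
  finite_set [set n : monomial L | norm_monomial i n = m].
Proof.
(* A finite overestimate: any prime above one occurring in [m], paired with any index occurring in
   [m]. *)
pose V := (\bigcup_(w in [set` finsupp m]) [set P | prime_below i P = w.1]) `*`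
  (snd @` [set` finsupp m]).
have Vfin : finite_set V.
  apply: finite_setX; last exact/finite_image/finite_fset.
  by apply: bigcup_finite => [|w _]; [exact: finite_fset|exact: finite_primes_above].
have VP (n : monomial L) v : norm_monomial i n = m -> n v != 0%N -> v \in fset_set V.
  move=> nm nv; rewrite in_fset_set // mem_set //.
  have : (below_var v) \in finsupp m.
    rewrite -cmE_neq0 -nm -lt0n; apply: leq_trans (norm_monomial_ge _ _).
    by rewrite lt0n.
  by move=> wm; split; exists (below_var v).
have n_le (n : monomial L) v : norm_monomial i n = m -> (n v < (mdeg m).+1)%N.
  move=> nm; rewrite ltnS; apply: leq_trans (norm_monomial_ge _ _) _; rewrite nm.
  rewrite mdegE; case: finsuppP => // wm.
  by rewrite (big_fsetD1 (below_var v)) ?leq_addr.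
pose f (n : monomial L) : {ffun fset_set V -> 'I_(mdeg m).+1} :=
  [ffun v => inord (n (val v))].
apply: (@finite_set_injl _ _ _ f) => n n' /set_mem /= nm /set_mem /= n'm.
move=> /ffunP eqn; apply/eqP/cmP => v.
have [vV|vV] := boolP (v \in fset_set V).
  by have := congr1 val (eqn [` vV]%fset); rewrite !ffunE /= !inordK ?n_le.
have n0 (n0 : monomial L) : norm_monomial i n0 = m -> n0 v = 0%N.
  by move=> n0m; apply/eqP; apply: contraNT vV; exact: VP.
by rewrite !n0.
Qed.

End NormMonomial.

Lemma norm_monomial_comp (K L E : fieldExtType rat)
    (i : {rmorphism K -> L}) (j : {rmorphism L -> E}) (m : monomial E) :
  norm_monomial (j \o i) m = norm_monomial i (norm_monomial j m).
Proof.
apply/eqP/cmP => w; rewrite (norm_monomialE _ _ (fsubset_refl _)).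
(* [D] contains both the support of the middle monomial and every [below_var j u], so after the
   exchange each [u] meets exactly one nonzero term. *)
pose D := (finsupp (norm_monomial j m) `|` [fset below_var j u | u in finsupp m])%fset.
rewrite (@norm_monomialE _ _ _ D) ?fsubsetUl //.
under [RHS]eq_bigr => v _ do
  rewrite (norm_monomialE _ _ (fsubset_refl _)) !big_distrr /=.
rewrite exchange_big /=; apply: eq_big_seq => u um.
have uD : below_var j u \in D by rewrite inE in_imfset ?orbT.
rewrite (big_fsetD1 _ uD) /= eqxx mul1n big1_seq ?addn0.
  by rewrite residue_degree_comp -mulnA {1}/below_var prime_below_comp.
move=> v /=; rewrite in_fsetD1 eq_sym => /andP[/negPf-> _].
by rewrite mul0n !muln0.
Qed.

(** * The degree of a monomial as an ideal *)

Section MultidegreeIdeal.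

Variable K : fieldExtType rat.
Notation O := (integers K).

Lemma ideal_mul_nonzero (I J : set O) :
  is_nonzero_ideal I -> is_nonzero_ideal J -> is_nonzero_ideal (ideal_mul I J).
Proof.
move=> [I0 ID IM [x xI x0]] [J0 JD JM [y yJ y0]]; split.
- by apply: mem_set; exists [::]; rewrite ?big_nil.
- move=> _ _ /set_mem[s sIJ ->] /set_mem[t tIJ ->]; apply: mem_set.
  exists (s ++ t); last by rewrite big_cat.
  by move=> u; rewrite mem_cat => /orP[/sIJ|/tIJ].
- move=> a _ /set_mem[s sIJ ->]; apply: mem_set.
  exists [seq (a * u.1, u.2) | u <- s].
    move=> _ /mapP[u /sIJ[uI uJ] ->]; split=> //=.
    by apply/set_mem/IM/mem_set.
  by rewrite big_map mulr_sumr; apply: eq_bigr => u _; rewrite mulrA.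
- exists (x * y).
    apply: mem_set; exists [:: (x, y)]; last by rewrite big_seq1.
    by move=> u; rewrite inE => /eqP ->; split; exact: set_mem.
  by rewrite -(inj_eq val_inj) rmorphM rmorph0 mulf_neq0.
Qed.

Lemma nonzero_ideal_setT : is_nonzero_ideal [set: O].
Proof.
split; [|move=> x y _ _|move=> a x _|]; try exact: mem_set.
by exists 1; [exact: mem_set|rewrite oner_neq0].
Qed.

Lemma nonzero_ideal_prime (q : prime_ideals O) : is_nonzero_ideal (prime_set q).
Proof.
case: q => q /= hq; case/asboolP: (hq) => -[q0 _ qD] _ qne; split=> //.
  by move=> x y xq yq; rewrite -[x]mul1r qD.
by move=> a x xq; rewrite -[_ * _]addr0 qD.
Qed.

Lemma prime_power_prod_nonzero (d : {fsfun prime_ideals O -> nat with 0%N}) :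
  is_nonzero_ideal (prime_power_prod d).
Proof.
rewrite /prime_power_prod; elim/big_rec: _ => [|q I _ IH].
  exact: nonzero_ideal_setT.
apply: ideal_mul_nonzero IH; rewrite /ideal_exp.
elim: (d q) => [|n IHn] /=; first exact: nonzero_ideal_setT.
exact: ideal_mul_nonzero (nonzero_ideal_prime q) IHn.
Qed.

Definition multidegree_ideal (m : monomial K) : ideals O :=
  MkIdeal (asboolT (prime_power_prod_nonzero (multidegree m))).

(* Only the term of degree multidegree m contributes to the coefficient of m,
   so that the sums over all ideals in norm_map have at most one term per
   monomial. *)
Definition graded (F : formal_sum K) :=
  forall a m, F a m != 0 -> a = multidegree_ideal m.

Lemma arith_sym_graded (F : formal_sum K) : arith_sym K F -> graded F.
Proof.
move=> hF a m; have [_ [d ad dF]] := hF a; move/dF => md.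
by apply: val_inj; rewrite /= md.
Qed.

End MultidegreeIdeal.

(** * Coefficients of the norm of a formal sum *)

Section NormMap.

Variables (K L : fieldExtType rat) (i : {rmorphism K -> L}) (F : formal_sum L).

(** The degree test in [norm_map] ensures this, so that the coefficient formula below applies to an
    iterated norm. *)
Lemma norm_map_graded : graded (norm_map i F).
Proof.
move=> b m; rewrite /norm_map; case: ifPn => [/eqP mb _|_]; last by rewrite eqxx.
by apply: val_inj; rewrite /= mb.
Qed.

Lemma norm_map_multidegree (m : monomial K) : graded F ->
  norm_map i F (multidegree_ideal m) m =
    \sum_(n \in [set n : monomial L | norm_monomial i n = m])
      F (multidegree_ideal n) n.
Proof.
move=> Fgr; rewrite /norm_map eqxx /norm_series.
set N := [set n : monomial L | _]; have Nfin : finite_set N := finite_norm_fiber i m.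
(* Only degrees of monomials in the finite fibre contribute; the sum over all ideals becomes finite
   and can be exchanged. *)
rewrite -(fsbig_widen (@multidegree_ideal L @` N)) //; last first.
  move=> a [_ aN] /=; apply: fsbig1 => n Nn; apply/eqP/negPn/negP => /Fgr aE.
  by apply: aN; exists n.
rewrite exchange_fsbig //; last exact: finite_image.
apply: eq_fsbigr => n /set_mem Nn.
rewrite -(fsbig_widen [set multidegree_ideal n]) ?fsbig_set1 // => [a ->|a [_ /= an]].
  by exists n.
by apply/eqP/negPn/negP => /Fgr.
Qed.

End NormMap.

Theorem proposition2p18 (K L E : fieldExtType rat)
    (iKL : {rmorphism K -> L}) (iLE : {rmorphism L -> E})
    (F : formal_sum E) (hF : arith_sym E F) :
  norm_map (iLE \o iKL) F = norm_map iKL (norm_map iLE F).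
Proof.
have Fgr := arith_sym_graded hF.
apply/funext => b; apply/funext => m.
(* Away from the degree of [m], both sides vanish by gradedness. *)
have [->|bm] := eqVneq b (multidegree_ideal m); last first.
  have zero G : graded G -> G b m = 0.
    by move=> Ggr; apply/eqP; apply: contraNT bm => /Ggr ->.
  by rewrite !zero //; exact: norm_map_graded.
rewrite !norm_map_multidegree //; last exact: norm_map_graded.
under [RHS]eq_fsbigr do rewrite norm_map_multidegree //.
(* The fibre of the composite over [m] is split according to the intermediate monomial of [L]. *)
rewrite (@fsbig_fibers _ _ _ _ [set n | norm_monomial iKL n = m] (norm_monomial iLE)).
- apply: eq_fsbigr => n /set_mem /= nm; apply: eq_fsbigl.
  apply/predeqP => k /=; rewrite norm_monomial_comp.
  by split=> [[] //|->].
- exact: finite_norm_fiber.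
- exact: finite_norm_fiber.
- by move=> k /=; rewrite norm_monomial_comp.
Qed.
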